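(* Let $n,d$ be positive integers, let $f$ be a real polynomial in $n$ variables of degree at most $d$, and let $d_f=2\lceil d/2\rceil$. Let $\lambda=(\lambda_\alpha)_{\alpha\in\mathcal I_{n+1,d_f}}$ be the unique solution of $\widehat V(n+1,d_f)^\top\lambda=c$, where $c$ is the coefficient vector of the form $f_H(x,x_h)=x_h^{d_f}f(x_1/x_h,\ldots,x_n/x_h)$ of degree $d_f$ in $n+1$ variables. Then $f$ has the power-sum-DC decomposition $$f(x)=\sum_{\alpha\in\mathcal I^+}\lambda_\alpha\langle\alpha,\hat x\rangle^{d_f}-\sum_{\alpha\in\mathcal I^-}(-\lambda_\alpha)\langle\alpha,\hat x\rangle^{d_f}\qquad(x\in\mathbb R^n),$$ where $\mathcal I^+=\{\alpha\in\mathcal I_{n+1,d_f}:\lambda_\alpha>0\}$, $\mathcal I^-=\{\alpha\in\mathcal I_{n+1,d_f}:\lambda_\alpha<0\}$ and $\hat x=\begin{pmatrix}x\\1\end{pmatrix}\in\mathbb R^{n+1}$.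
   Context: For positive integers $n,d$: $\mathcal I_{n,d}=\{\alpha\in\mathbb N^n:\sum_{i=1}^n\alpha_i=d\}$ with $\mathbb N=\{0,1,\ldots\}$, of cardinality $s_{n,d}=\binom{n+d-1}{d}$, enumerated in a fixed order as $\alpha^1,\ldots,\alpha^{s_{n,d}}$. The coefficient vector of a form $\sum_{\alpha\in\mathcal I_{n,d}}c_\alpha x^\alpha$ is $c=(c_{\alpha^1},\ldots,c_{\alpha^{s_{n,d}}})^\top$. The power-product matrix is $\widehat V(n,d)=\big(\binom{d}{\alpha^j}(\alpha^i)^{\alpha^j}\big)_{1\le i,j\le s_{n,d}}$ with $\binom{d}{\alpha^j}=\frac{d!}{\alpha^j_1!\cdots\alpha^j_n!}$ and $(\alpha^i)^{\alpha^j}=\prod_{k=1}^n(\alpha^i_k)^{\alpha^j_k}$, $0^0=1$; it is known to be nonsingular for all positive integers $n,d$. A power-sum-DC (PSDC) decomposition of a polynomial is an expression of it as a difference $g-h$ of two convex polynomials, each of which is a nonnegative linear combination of even powers of linear forms (here in $\hat x$, i.e. affine functions of $x$). *)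

(* Defs.v *)
From HB Require Import structures.
From mathcomp Require Import all_boot all_order all_algebra.
From mathcomp Require Import boolp classical_sets reals interval_inference convex.
From mathcomp Require Import mpoly.

Set Implicit Arguments.
Unset Strict Implicit.
Unset Printing Implicit Defensive.

Import Order.TTheory GRing.Theory Num.Theory.
Local Open Scope ring_scope.

(* The index set I_{n,d}. The bound < d.+1 on the total degree only serves to
   make the type finite. *)
Record form_index (n d : nat) : predArgType := FormIndex {
  index_mnm :> 'X_{1..n < d.+1};
  _ : mdeg index_mnm == d
}.

HB.instance Definition _ n d := [isSub for @index_mnm n d].
HB.instance Definition _ n d := [Finite of form_index n d by <:].

Definition nforms (n d : nat) : nat := 'C(n + d - 1, d).

(* [alpha] enumerates the index set as alpha^1, ..., alpha^(s_{n,d}). *)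
Definition enumeration (n d : nat) (alpha : 'I_(nforms n d) -> form_index n d) :=
  bijective alpha.

Section PowerProduct.
Context {R : realType} {n d : nat} (alpha : 'I_(nforms n d) -> form_index n d).

Definition multinomial_coef (a : form_index n d) : R :=
  (d`!)%:R / \prod_(k < n) ((a k)`!)%:R.

(* The powers are those of nat, so that 0 ^ 0 = 1. *)
Definition power_product_mx : 'M[R]_(nforms n d) :=
  \matrix_(i, j) (multinomial_coef (alpha j) *
                  (\prod_(k < n) (alpha i k ^ alpha j k)%N)%:R).

Definition coef_vector (p : {mpoly R[n]}) : 'cV[R]_(nforms n d) :=
  \col_i p@_(alpha i).

Definition family_vector (lambda : {ffun form_index n d -> R}) :
  'cV[R]_(nforms n d) := \col_i lambda (alpha i).

End PowerProduct.

Section Polynomials.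
Context {R : realType} {n : nat}.

Definition evalc (p : {mpoly R[n]}) (x : 'cV[R]_n) : R :=
  p.@[fun i => x i 0].

(* The form x_h ^ D * f (x / x_h) in the n + 1 variables (x, x_h), for f of
   degree at most D; see [evalc_homogenize] and [homogenize_homog]. *)
Definition homogenize_mnm (D : nat) (m : 'X_{1..n}) : 'X_{1..n + 1} :=
  [multinom match split k with inl i => m i | inr _ => (D - mdeg m)%N end
   | k < n + 1].

Definition homogenize (D : nat) (f : {mpoly R[n]}) : {mpoly R[n + 1]} :=
  \sum_(m <- msupp f) f@_m *: 'X_[homogenize_mnm D m].

Definition hat (x : 'cV[R]_n) : 'cV[R]_(n + 1) := col_mx x 1%:M.

Definition linear_form {m : nat} (u : 'I_m -> R) (v : 'cV[R]_m) : R :=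
  \sum_(k < m) u k * v k 0.

Definition polynomial_function (g : 'cV[R]_n -> R) :=
  exists p : {mpoly R[n]}, forall x, g x = evalc p x.

Definition convex_polynomial (g : 'cV[R]_n -> R) :=
  polynomial_function g /\ @convex_function R 'cV[R]_n setT g.

Definition even_power_sum (g : 'cV[R]_n -> R) :=
  exists (N : nat) (w : 'I_N -> R) (u : 'I_N -> 'I_(n + 1) -> R)
         (e : 'I_N -> nat),
    (forall i, 0 <= w i /\ ~~ odd (e i)) /\
    (forall x, g x = \sum_(i < N) w i * linear_form (u i) (hat x) ^+ e i).

Definition psdc_decomposition (f : {mpoly R[n]}) (g h : 'cV[R]_n -> R) :=
  [/\ forall x, evalc f x = g x - h x,
      convex_polynomial g /\ even_power_sum g &
      convex_polynomial h /\ even_power_sum h].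

End Polynomials.

Definition index_vec {R : realType} {n d : nat} (a : form_index n d) :
  'I_n -> R := fun k => (a k)%:R.

Definition pos_indices {R : realType} {n d : nat}
  (lambda : {ffun form_index n d -> R}) : {set form_index n d} :=
  [set a | 0 < lambda a]%SET.

Definition neg_indices {R : realType} {n d : nat}
  (lambda : {ffun form_index n d -> R}) : {set form_index n d} :=
  [set a | lambda a < 0]%SET.

Section Facts.
Context {R : realType} {n : nat}.

Lemma mdeg_homogenize_mnm D (m : 'X_{1..n}) :
  (mdeg m <= D)%N -> mdeg (homogenize_mnm D m) = D.
Proof.
move=> mD; rewrite mdegE big_split_ord /= big_ord1.
under eq_bigr => i _ do rewrite mnmE (unsplitK (inl i : 'I_n + 'I_1)%type).
by rewrite mnmE (unsplitK (inr ord0 : 'I_n + 'I_1)%type) -mdegE subnKC.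
Qed.

Lemma homogenize_homog D (f : {mpoly R[n]}) :
  (msize f <= D.+1)%N -> homogenize D f \is D.-homog.
Proof.
move=> fD; rewrite /homogenize big_seq; apply: rpred_sum => m mf.
apply: rpredZ; rewrite dhomogX; apply/eqP/mdeg_homogenize_mnm.
by rewrite -ltnS (leq_trans (msize_mdeg_lt mf)).
Qed.

Lemma evalc_homogenize D (f : {mpoly R[n]}) (x : 'cV[R]_n) (t : R) :
  (msize f <= D.+1)%N -> t != 0 ->
  evalc (homogenize D f) (col_mx x t%:M) = t ^+ D * evalc f (t^-1 *: x).
Proof.
move=> fD t0; rewrite /evalc /homogenize raddf_sum /= mevalE mulr_sumr.
rewrite big_seq [RHS]big_seq; apply: eq_bigr => m mf.
have mD : (mdeg m <= D)%N by rewrite -ltnS (leq_trans (msize_mdeg_lt mf)).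
rewrite mevalZ mevalX mulrCA; congr (_ * _).
rewrite big_split_ord /= big_ord1 col_mxEd mxE eqxx mulr1n.
rewrite mnmE (unsplitK (inr ord0 : 'I_n + 'I_1)%type).
under eq_bigr => i _ do
  rewrite col_mxEu mnmE (unsplitK (inl i : 'I_n + 'I_1)%type).
under [in RHS]eq_bigr => i _ do rewrite mxE exprMn.
rewrite big_split /= prodrXr -mdegE mulrA mulrC; congr (_ * _).
by rewrite -[in RHS](subnK mD) exprD -mulrA -exprMn divff// expr1n mulr1.
Qed.

End Facts.

Lemma card_form_index n d : (0 < n)%N -> #|form_index n d| = nforms n d.
Proof.
case: n => // n _; rewrite /nforms addSn subn1 /= addnC -size_basis.
pose s := [seq s2m t | t : d.-tuple 'I_n.+1 <- enum (basis n.+1 d)].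
rewrite -[RHS]/(size s) cardE -(size_map (fun a : form_index n.+1 d => a : 'X_{1..n.+1})).
apply/perm_size/uniq_perm.
- by rewrite map_inj_uniq ?enum_uniq // => a b ab; do 2!apply: val_inj.
- exact: uniq_basis.
move=> m; rewrite -basis_cover; apply/mapP/eqP => [[a _ ->]|md].
  by apply/eqP; case: a.
have mlt : (mdeg m < d.+1)%N by rewrite md.
exists (@FormIndex n.+1 d (BMultinom mlt) (introT eqP md)) => //.
by rewrite mem_enum.
Qed.

Lemma enumeration_exists n d : (0 < n)%N ->
  exists alpha : 'I_(nforms n d) -> form_index n d, enumeration alpha.
Proof.
move=> n0; have e := card_form_index d n0.
exists (enum_val \o cast_ord (esym e)).
exists (cast_ord e \o enum_rank) => x /=; first by rewrite enum_valK cast_ordKV.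
by rewrite cast_ordK enum_rankK.
Qed.

(* Main.v *)
Require Import Defs.
From mathcomp Require Import all_boot all_order all_algebra.
From mathcomp Require Import boolp classical_sets reals interval_inference convex.
From mathcomp Require Import mpoly ring.
Import Order.TTheory GRing.Theory Num.Theory.
Local Open Scope ring_scope.

(** By the multinomial theorem, the coefficient vector of a combination of the
   powers <alpha, y> ^ D, alpha in I_{N,D}, is the transposed power-product
   matrix applied to the vector of weights ([evalc_power_sum]).  Solving the
   linear system for the coefficients of f_H thus writes f_H as such a
   combination, and setting x_h = 1 writes f as a combination of powers of
   affine functions.  The terms of positive and of negative weight give the two
   parts; since D is even, each of them is a nonnegative combination of even
   powers of affine functions, hence convex
   ([even_power_sum_convex_polynomial]).

   What remains is existence and uniqueness of the weights, that is, the
   nonsingularity of the power-product matrix ([power_product_mx_unit]).  Up to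
   nonzero column factors, that matrix maps the coefficients of a form of degree
   D to its values at the points alpha of I_{N,D}, so it is enough to
   interpolate arbitrary values at these points by forms of degree D.  The
   Lagrange basis is explicit: for beta in I_{N,D} take
     L_beta = prod_k prod_(j < beta_k) (D x_k - j (x_1 + ... + x_N)),
   a product of D linear forms.  At alpha in I_{N,D} the coordinates sum to D,
   so its factors are D (alpha_k - j), and the product vanishes as soon as
   alpha_k < beta_k for some k.  As alpha and beta have the same sum, this
   happens for every alpha other than beta, whereas L_beta (beta) is nonzero
   ([lattice_lagrange_eq0]). *)

(** * Homogeneous polynomials and the multinomial theorem *)

Section HomogeneousForms.
Context {R : realType} {n : nat}.

Lemma meval_homog d (p : {mpoly R[n]}) (v : 'I_n -> R) : p \is d.-homog ->
  p.@[v] = \sum_(a : form_index n d) p@_a * \prod_(k < n) v k ^+ a k.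
Proof.
move=> hp; rewrite {1}(@mpolywE _ _ d.+1 p); last first.
  by rewrite msizeE; apply/bigmax_leqP_seq => m mp _; rewrite ltnS (dhomog_mf hp mp).
rewrite raddf_sum /=.
rewrite (bigID (fun m : 'X_{1..n < d.+1} => mdeg m == d)) /= addrC big1 ?add0r.
  rewrite (reindex_omap (val : form_index n d -> 'X_{1..n < d.+1}) insub) /=.
    apply: eq_big => [a|a _]; last by rewrite mevalZ mevalX.
    by rewrite valK eqxx andbT; case: a.
  by move=> m md; rewrite insubT.
by move=> m md; rewrite (dhomog_nemf_coeff hp md) scale0r raddf0.
Qed.

Lemma dhomog_prod_ord N (F : 'I_N -> {mpoly R[n]}) (e : 'I_N -> nat) :
  (forall i, F i \is (e i).-homog) -> \prod_i F i \is (\sum_i e i).-homog.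
Proof.
move=> hF; apply: (big_ind2 (fun (p : {mpoly R[n]}) k => p \is k.-homog)) => //.
- exact: dhomog1.
- by move=> p k q l; apply: dhomogM.
Qed.

Lemma dhomog_var (k : 'I_n) : ('X_k : {mpoly R[n]}) \is 1.-homog.
Proof. by rewrite dhomogX; apply/eqP/mdeg1. Qed.

Definition var_sum : {mpoly R[n]} := \sum_(k < n) 'X_k.

Lemma dhomog_var_sum : var_sum \is 1.-homog.
Proof. by apply: rpred_sum => k _; apply: dhomog_var. Qed.

Lemma meval_var_sum v : var_sum.@[v] = \sum_(k < n) v k.
Proof. by rewrite raddf_sum; apply: eq_bigr => k _; rewrite /= mevalXU. Qed.

Lemma mderiv_var_sum_expn k d :
  (var_sum ^+ d.+1)^`M(k) = (var_sum ^+ d) *+ d.+1.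
Proof.
have S' : var_sum^`M(k) = 1.
  rewrite raddf_sum (bigD1 k) //= mderivX mnm1E eqxx scale1r.
  have -> : (U_(k) - U_(k) = 0)%MM by apply/mnmP => i; rewrite !mnmE subnn.
  rewrite mpolyX0 big1 ?addr0 // => i ik.
  by rewrite mderivX mnm1E (negPf ik) scale0r.
elim: d => [|d IH]; first by rewrite expr1 S' expr0.
by rewrite exprSr mderivM IH S' mulr1 mulrnAl -exprSr -mulrSr.
Qed.

(** Differentiating the power of the sum of the variables lowers the exponent by
   one and shifts the coefficients by one variable, which gives an induction on
   the degree: m = m' + U_k for some variable k occurring in m, and the factor
   m_k of m! comes from the derivation. *)
Lemma mcoeff_var_sum_expn (m : 'X_{1..n}) :
  (var_sum ^+ mdeg m)@_m = (mdeg m)`!%:R / \prod_(k < n) (m k)`!%:R.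
Proof.
have fact_neq0 j : j`!%:R != 0 :> R by rewrite pnatr_eq0 -lt0n fact_gt0.
move: {2}(mdeg m) (erefl (mdeg m)) => d; elim: d m => [|d IH] m md.
  move/eqP: md; rewrite mdeg_eq0 => /eqP ->.
  by rewrite mdeg0 expr0 mcoeff1 eqxx big1 ?divr1 // => k _; rewrite mnm0E.
have [k mk] : exists k, (0 < m k)%N.
  apply/existsP; apply: contraT; rewrite negb_exists => /forallP m0.
  suff : mdeg m = 0%N by rewrite md.
  by rewrite mdegE big1 // => k _; apply/eqP; rewrite -leqn0 leqNgt m0.
have [m' mE] : exists m', m = (m' + U_(k))%MM.
  exists (m - U_(k))%MM; rewrite submK //; apply/mnm_lepP => i.
  by rewrite mnm1E; case: eqP => // <-.
have m'd : mdeg m' = d by move: md; rewrite mE mdegD mdeg1 addn1 => -[].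
have := congr1 (mcoeff m') (mderiv_var_sum_expn k d).
rewrite mcoeff_mderiv -mE mcoeffMn -{2}m'd IH // md m'd.
have -> : \prod_(i < n) (m i)`!%:R = (\prod_(i < n) (m' i)`!%:R) *+ (m' k).+1 :> R.
  rewrite (bigD1 k) //= [in RHS](bigD1 k) //= -mulrnAl mE.
  rewrite mnmDE mnm1E eqxx addn1 factS mulnC natrM mulr_natr; congr (_ * _).
  by apply: eq_bigr => i ik; rewrite mnmDE mnm1E eq_sym (negPf ik) addn0.
have P0 : \prod_(i < n) (m' i)`!%:R != 0 :> R.
  by apply/prodf_neq0 => i _; apply: fact_neq0.
move: P0; set P := \prod_(i < n) _ => P0 E.
apply: (@mulIf _ (m' k).+1%:R); first by rewrite pnatr_eq0.
rewrite mulr_natr E factS natrM -[P *+ _]mulr_natr invfM.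
by rewrite !mulrA divfK ?pnatr_eq0 // -[LHS]mulr_natl mulrA.
Qed.

Lemma multinomial_theorem d (v : 'I_n -> R) :
  (\sum_(k < n) v k) ^+ d =
  \sum_(a : form_index n d) multinomial_coef a * \prod_(k < n) v k ^+ a k.
Proof.
rewrite -meval_var_sum -rmorphXn /= (meval_homog d); last first.
  by rewrite -[d in d.-homog]mul1n; apply: dhomogMn; apply: dhomog_var_sum.
apply: eq_bigr => a _; congr (_ * _).
have /eqP ad : mdeg a == d by case: a.
by have := mcoeff_var_sum_expn a; rewrite ad.
Qed.

(** * Lagrange interpolation at the lattice points of the simplex *)

Lemma multinomial_coef_neq0 d (a : form_index n d) : multinomial_coef a != 0 :> R.
Proof.
rewrite mulf_neq0 ?invr_eq0 ?pnatr_eq0 -?lt0n ?fact_gt0 //.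
by apply/prodf_neq0 => k _; rewrite pnatr_eq0 -lt0n fact_gt0.
Qed.

(** On the hyperplane of coordinate sum d this is d ^ d times the product over k
   of the falling factorials x_k (x_k - 1) ... (x_k - b_k + 1).  Replacing the
   constants j by j (x_1 + ... + x_n) / d makes the polynomial homogeneous
   without changing it there, and the factor d of each linear form clears the
   denominator. *)
Definition lattice_lagrange d (b : form_index n d) : {mpoly R[n]} :=
  \prod_(k < n) \prod_(j < b k) (d%:R *: 'X_k - j%:R *: var_sum).

Lemma lattice_lagrange_homog d (b : form_index n d) :
  lattice_lagrange d b \is d.-homog.
Proof.
have /eqP {2}<- : mdeg b == d by case: b.
rewrite mdegE; apply: dhomog_prod_ord => k.
rewrite -[b k as X in X.-homog]card_ord -sum1_card.
apply: dhomog_prod_ord => j; apply: rpredB; apply: rpredZ.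
  exact: dhomog_var.
exact: dhomog_var_sum.
Qed.

Lemma meval_lattice_lagrange d (a b : form_index n d) :
  (lattice_lagrange d b).@[index_vec a] =
  \prod_(k < n) \prod_(j < b k) (d%:R * ((a k)%:R - j%:R)).
Proof.
rewrite rmorph_prod; apply: eq_bigr => k _.
rewrite rmorph_prod; apply: eq_bigr => j _ /=.
rewrite mevalB !mevalZ mevalXU meval_var_sum -natr_sum -mdegE.
have /eqP -> : mdeg a == d by case: a.
by rewrite mulrBr [j%:R * _]mulrC.
Qed.

(** Two points of the same coordinate sum are equal as soon as one dominates the
   other, so a differs from b exactly when a k < b k for some k; then j = a k is
   among the indices of the k-th product, and its factor vanishes at a. *)
Lemma lattice_lagrange_eq0 d (a b : form_index n d) :
  ((lattice_lagrange d b).@[index_vec a] == 0) = (a != b).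
Proof.
have [/eqP ad /eqP bd] : mdeg a == d /\ mdeg b == d by case: a; case: b.
rewrite meval_lattice_lagrange; apply/idP/idP.
  apply: contraL => /eqP ->.
  apply/prodf_neq0 => k _; apply/prodf_neq0 => j _.
  (* the factor d is nonzero because d >= b k > j *)
  rewrite mulf_eq0 negb_or subr_eq0 pnatr_eq0 eqr_nat.
  rewrite [b k == j]gtn_eqF // andbT -bd mdegE (bigD1 k) //= -lt0n.
  by rewrite (leq_trans _ (leq_addr _ _)) // (leq_trans _ (ltn_ord j)).
move=> ab; have [k kab] : exists k, (a k < b k)%N.
  apply/existsP; apply: contraNT ab; rewrite negb_exists => /forallP le_ba.
  have le_ba' : ((b : 'X_{1..n}) <= a)%MM.
    by apply/mnm_lepP => k; rewrite leqNgt.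
  apply/eqP; do 2!apply: val_inj; rewrite /= -(submK le_ba').
  have := congr1 (@mdeg n) (submK le_ba').
  rewrite mdegD ad bd -[RHS]add0n => /addIn /eqP; rewrite mdeg_eq0 => /eqP ->.
  by rewrite add0m.
rewrite (bigD1 k) //= (bigD1 (Ordinal kab)) //= subrr mulr0.
by rewrite !mul0r.
Qed.

Section Interpolation.
Context {d : nat} (alpha : 'I_(nforms n d) -> form_index n d).
Context (alpha_enum : enumeration alpha).

Lemma sum_enumeration (F : form_index n d -> R) :
  \sum_a F a = \sum_i F (alpha i).
Proof. by rewrite (reindex alpha) //; apply: onW_bij. Qed.

(** The right inverse W consists of the coefficients of the Lagrange basis,
   normalised to take the value 1 at their own point; dividing by the
   multinomial coefficients cancels the column factors of the power-product
   matrix. *)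
Lemma power_product_mx_unit : (power_product_mx alpha : 'M[R]_(nforms n d)) \in unitmx.
Proof.
pose L b := lattice_lagrange d b.
pose W : 'M[R]_(nforms n d) := \matrix_(j, l)
  ((L (alpha l))@_(alpha j) / multinomial_coef (alpha j)
   / (L (alpha l)).@[index_vec (alpha l)]).
suff VW : power_product_mx alpha *m W = 1%:M by case/mulmx1_unit: VW.
apply/matrixP => i l; rewrite !mxE.
transitivity ((L (alpha l)).@[index_vec (alpha i)]
              / (L (alpha l)).@[index_vec (alpha l)]).
  rewrite (meval_homog d _ (index_vec (alpha i))); last exact: lattice_lagrange_homog.
  rewrite sum_enumeration mulr_suml; apply: eq_bigr => j _.
  rewrite !mxE natr_prod mulrA; congr (_ / _).
  rewrite mulrC mulrA mulfVK ?multinomial_coef_neq0 //; congr (_ * _).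
  by apply: eq_bigr => k _; rewrite natrX.
have [<-|il] := eqVneq i l; first by rewrite divff // lattice_lagrange_eq0 negbK.
have /eqP -> : (L (alpha l)).@[index_vec (alpha i)] == 0.
  by rewrite lattice_lagrange_eq0 (inj_eq (bij_inj alpha_enum)).
by rewrite mul0r.
Qed.

Lemma family_vector_inj : injective (@family_vector R n d alpha).
Proof.
move=> l1 l2 /matrixP E; apply/ffunP => a.
have [g _ gK] := alpha_enum.
by have := E (g a) 0; rewrite !mxE gK.
Qed.

Lemma family_vector_surj (w : 'cV[R]_(nforms n d)) :
  exists lambda, family_vector alpha lambda = w.
Proof.
have [g gK _] := alpha_enum.
exists [ffun a => w (g a) 0]; apply/matrixP => i j.
by rewrite !mxE ffunE gK ord1.
Qed.

Lemma exists_unique_coefficients (c : 'cV[R]_(nforms n d)) :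
  exists! lambda, (power_product_mx alpha)^T *m family_vector alpha lambda = c.
Proof.
have Vu : ((power_product_mx alpha)^T : 'M[R]_(nforms n d)) \in unitmx.
  by rewrite unitmx_tr power_product_mx_unit.
have [l lE] := family_vector_surj (invmx (power_product_mx alpha)^T *m c).
exists l; split; first by rewrite lE mulKVmx.
by move=> l' l'E; apply: family_vector_inj; rewrite lE -l'E mulKmx.
Qed.

(** The i-th equation of the system says that p and the power sum have the same
   coefficient at alpha i; expanding the powers by the multinomial theorem turns
   this into an equality of values. *)
Lemma evalc_power_sum (p : {mpoly R[n]}) (lambda : {ffun form_index n d -> R})
    (y : 'cV[R]_n) : p \is d.-homog ->
  (power_product_mx alpha)^T *m family_vector alpha lambda = coef_vector alpha p ->
  evalc p y = \sum_a lambda a * linear_form (index_vec a) y ^+ d.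
Proof.
move=> hp hl; rewrite /evalc (meval_homog d) // sum_enumeration [RHS]sum_enumeration.
have coefE i : p@_(alpha i) =
    \sum_j (power_product_mx alpha)^T i j * family_vector alpha lambda j 0.
  by have /matrixP /(_ i 0) := hl; rewrite !mxE => <-.
under eq_bigr => i _ do rewrite coefE mulr_suml.
rewrite exchange_big; apply: eq_bigr => j _ /=.
rewrite multinomial_theorem sum_enumeration mulr_sumr.
apply: eq_bigr => i _; rewrite !mxE [_ * lambda _]mulrC -mulrA.
congr (_ * _); rewrite -mulrA; congr (_ * _).
rewrite natr_prod -big_split; apply: eq_bigr => k _ /=.
by rewrite natrX exprMn.
Qed.

End Interpolation.

End HomogeneousForms.

(** * Convexity of sums of even powers of affine functions *)

Section ConvexPowerSums.
Context {R : realType} {n : nat}.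

(** Multiplying the inequality for m by t a + (1 - t) b gives a bound that
   falls short of t a ^ (m + 1) + (1 - t) b ^ (m + 1) by
   t (1 - t) (a - b) (a ^ m - b ^ m), which is nonnegative because the m-th
   power is monotone on nonnegative numbers. *)
Lemma conv_expn_ge0 (t a b : R) m : 0 <= t <= 1 -> 0 <= a -> 0 <= b ->
  (t * a + (1 - t) * b) ^+ m <= t * a ^+ m + (1 - t) * b ^+ m.
Proof.
move=> /andP[t0 t1] a0 b0; have s0 : 0 <= 1 - t by rewrite subr_ge0.
elim: m => [|m IH]; first by rewrite !expr0 !mulr1 addrC subrK.
rewrite exprS (le_trans (ler_wpM2l _ IH)) ?addr_ge0 ?mulr_ge0 //.
rewrite -subr_ge0 !exprS.
have -> : t * (a * a ^+ m) + (1 - t) * (b * b ^+ m)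
    - (t * a + (1 - t) * b) * (t * a ^+ m + (1 - t) * b ^+ m)
    = t * (1 - t) * ((a - b) * (a ^+ m - b ^+ m)).
  by ring.
apply: mulr_ge0; first exact: mulr_ge0.
have [ab|/ltW ba] := leP a b.
  by rewrite mulr_le0 // subr_le0 // lerXn2r.
by rewrite mulr_ge0 // subr_ge0 // lerXn2r.
Qed.

(** An even power is a power of the square: the square is convex and
   nonnegative, and powers are monotone and convex on nonnegative numbers. *)
Lemma conv_even_expn (t a b : R) e : 0 <= t <= 1 -> ~~ odd e ->
  (t * a + (1 - t) * b) ^+ e <= t * a ^+ e + (1 - t) * b ^+ e.
Proof.
move=> t01 oe; have /andP[t0 t1] := t01.
rewrite -[e]odd_double_half (negPf oe) add0n -mul2n !exprM.
apply: le_trans (conv_expn_ge0 _ _ _ _ t01 (sqr_ge0 a) (sqr_ge0 b)).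
have sqr_conv : (t * a + (1 - t) * b) ^+ 2 <= t * a ^+ 2 + (1 - t) * b ^+ 2.
  rewrite -subr_ge0.
  have -> : t * a ^+ 2 + (1 - t) * b ^+ 2 - (t * a + (1 - t) * b) ^+ 2
      = t * (1 - t) * (a - b) ^+ 2 by ring.
  by rewrite mulr_ge0 ?sqr_ge0 // mulr_ge0 // subr_ge0.
apply: lerXn2r => //; rewrite nnegrE ?sqr_ge0 //.
exact: le_trans (sqr_ge0 _) sqr_conv.
Qed.

Lemma linear_form_hat (u : 'I_(n + 1) -> R) (x : 'cV[R]_n) :
  linear_form u (hat x) =
  \sum_(k < n) u (lshift 1 k) * x k 0 + u (rshift n ord0).
Proof.
rewrite /linear_form big_split_ord big_ord1 /= /hat col_mxEd mxE eqxx mulr1.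
by congr (_ + _); apply: eq_bigr => k _; rewrite col_mxEu.
Qed.

Lemma linear_form_hat_conv (u : 'I_(n + 1) -> R) (t : R) (x y : 'cV[R]_n) :
  linear_form u (hat (t *: x + (1 - t) *: y)) =
  t * linear_form u (hat x) + (1 - t) * linear_form u (hat y).
Proof.
rewrite !linear_form_hat !mulrDr addrACA -[_ * u _ + _ * u _]mulrDl.
rewrite [t + _]addrC subrK mul1r; congr (_ + _).
rewrite !mulr_sumr -big_split /=; apply: eq_bigr => k _; rewrite !mxE.
by ring.
Qed.

Lemma even_power_sum_convex_polynomial (g : 'cV[R]_n -> R) :
  even_power_sum g -> convex_polynomial g.
Proof.
move=> [N [w [u [e [we gE]]]]]; split.
  exists (\sum_(i < N) w i *: (\sum_(k < n) u i (lshift 1 k) *: 'X_k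
                                 + (u i (rshift n ord0))%:MP) ^+ e i) => x.
  rewrite gE /evalc raddf_sum; apply: eq_bigr => i _ /=.
  rewrite mevalZ rmorphXn /= mevalD mevalC raddf_sum linear_form_hat.
  congr (_ * (_ + _) ^+ _).
  by apply: eq_bigr => k _; rewrite /= mevalZ mevalXU.
move=> t x y _ _; rewrite convRE !gE !mulr_sumr -big_split /=.
apply: ler_sum => i _; have [w0 oe] := we i.
rewrite [X in hat X](_ : _ = t%:num *: x + (1 - t%:num) *: y) //.
rewrite linear_form_hat_conv ![_ * (w i * _)]mulrCA -mulrDr.
apply: ler_wpM2l => //; apply: conv_even_expn => //.
by apply/andP; split.
Qed.

Lemma even_power_sum_family d (A : {set form_index (n + 1) d})
    (w : form_index (n + 1) d -> R) :
  ~~ odd d -> {in A, forall a, 0 <= w a} ->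
  even_power_sum (fun x : 'cV[R]_n =>
    \sum_(a in A) w a * linear_form (index_vec a) (hat x) ^+ d).
Proof.
move=> od w0; exists #|A|, (fun i => w (enum_val i)).
exists (fun i => index_vec (enum_val i)), (fun=> d); split => [i|x].
  by split=> //; apply/w0/enum_valP.
by rewrite big_enum_val.
Qed.

End ConvexPowerSums.

(** * The decomposition *)

Lemma sum_pos_neg_indices (R : realType) n d (lambda : {ffun form_index n d -> R})
    (F : form_index n d -> R) :
  \sum_a lambda a * F a = \sum_(a in pos_indices lambda) lambda a * F a
    - \sum_(a in neg_indices lambda) (- lambda a) * F a.
Proof.
rewrite -sumrN (bigID (mem (pos_indices lambda))) /=; congr (_ + _).
rewrite (bigID (mem (neg_indices lambda))) /= [X in _ + X]big1 ?addr0.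
  apply: eq_big => [a|a _]; last by rewrite mulNr opprK.
  by rewrite !inE andbC; case: ltgtP.
by move=> a; rewrite !inE -!leNgt => /le_anti ->; rewrite mul0r.
Qed.

Theorem proposition2 (R : realType) (n d : nat) (hn : (0 < n)%N) (hd : (0 < d)%N)
  (f : {mpoly R[n]}) (hf : (msize f <= d.+1)%N)
  (df : nat) (hdf : df = (2 * uphalf d)%N)
  (alpha : 'I_(nforms (n + 1) df) -> form_index (n + 1) df)
  (halpha : enumeration alpha) :
  let V : 'M[R]_(nforms (n + 1) df) := power_product_mx alpha in
  let c := coef_vector alpha (homogenize df f) in
  (exists! lambda : {ffun form_index (n + 1) df -> R},
     V^T *m family_vector alpha lambda = c) /\
  (forall lambda : {ffun form_index (n + 1) df -> R},
     V^T *m family_vector alpha lambda = c ->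
     psdc_decomposition f
       (fun x : 'cV[R]_n => \sum_(a in pos_indices lambda)
          lambda a * linear_form (index_vec a) (hat x) ^+ df)
       (fun x : 'cV[R]_n => \sum_(a in neg_indices lambda)
          (- lambda a) * linear_form (index_vec a) (hat x) ^+ df)).
Proof.
move=> V c.
have df_even : ~~ odd df by rewrite hdf mul2n odd_double.
have f_df : (msize f <= df.+1)%N.
  apply: leq_trans hf _; rewrite ltnS hdf mul2n -{1}[d]odd_double_half.
  by rewrite uphalf_half doubleD leq_add2r; case: (odd d).
split; first exact: exists_unique_coefficients.
move=> lambda hl; split.
- move=> x; rewrite -sum_pos_neg_indices.
  rewrite -(evalc_power_sum alpha halpha (homogenize df f)) //; last first.
    exact: homogenize_homog.
  by rewrite evalc_homogenize ?oner_eq0 // expr1n mul1r invr1 scale1r.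
- have G : even_power_sum (fun x : 'cV[R]_n => \sum_(a in pos_indices lambda)
      lambda a * linear_form (index_vec a) (hat x) ^+ df).
    by apply: even_power_sum_family => // a; rewrite inE => /ltW.
  by split; first exact: even_power_sum_convex_polynomial.
- have H : even_power_sum (fun x : 'cV[R]_n => \sum_(a in neg_indices lambda)
      (- lambda a) * linear_form (index_vec a) (hat x) ^+ df).
    by apply: even_power_sum_family => // a; rewrite inE oppr_ge0 => /ltW.
  by split; first exact: even_power_sum_convex_polynomial.
Qed.
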